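(* Let $\mathcal G$ be the graph with vertex set $V=(\mathbb{N}\times\mathbb{N})\setminus\{(0,0)\}$ (where $\mathbb{N}=\{0,1,2,\dots\}$), in which two distinct vertices $(a,b),(c,d)$ are adjacent if and only if $a=c=0$, or $b=d=0$, or ($a<c$ and $b>d$), or ($a>c$ and $b<d$). Then $\mathcal G$ is cop-win. Furthermore, for any two vertices $u,v$ of $\mathcal G$ there exists $n\in\mathbb{N}$ such that if the cop starts at $v$ and the robber starts at $u$, the cop can catch the robber in at most $n$ turns. However, there is no $n\in\mathbb{N}$ such that this holds for all pairs of initial positions $u,v$.
   Context: The game of cops and robbers on a graph $G$: the cop chooses a starting vertex, then the robber chooses a starting vertex; then they alternately move, the cop moving first, where a move consists of moving to an adjacent vertex or staying put. The cop wins if at some point he occupies the same vertex as the robber. $G$ is cop-win if the cop has a winning strategy. *)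

(* Defs.v *)
From mathcomp Require Import all_boot.

Set Implicit Arguments.
Unset Strict Implicit.
Unset Printing Implicit Defensive.

Record sgraph := SGraph {
  vertex :> Type;
  adj : rel vertex;
  adj_sym : symmetric adj;
  adj_irr : irreflexive adj }.

Section CopsAndRobbers.

Variable G : sgraph.

Definition move (x y : G) : Prop := x = y \/ adj x y.

(* [r n] is the robber's position after his [n]-th move, [r 0] being his
   starting vertex. Since the cop strategies below are deterministic,
   quantifying over all such sequences covers every adaptive behaviour of the
   robber. *)
Definition robber_play (r : nat -> G) : Prop := forall n, move (r n) (r n.+1).

(* The cop's next vertex, as a function of the robber's positions so far in
   chronological order. The cop's own past positions are determined by these
   and by his starting vertex. *)
Definition cop_strategy := seq G -> G.

(* The cop moves first, so his [n.+1]-st move is made knowing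
   [r 0], ..., [r n]. *)
Definition cop_pos (c0 : G) (s : cop_strategy) (r : nat -> G) (n : nat) : G :=
  if n is m.+1 then s (mkseq r m.+1) else c0.

Definition legal (c0 : G) (s : cop_strategy) : Prop :=
  forall r, robber_play r ->
  forall n, move (cop_pos c0 s r n) (cop_pos c0 s r n.+1).

(* A turn is a cop move followed by a robber move. The players meet either at
   the end of turn [k] (or initially, if [k = 0]), or right after the cop's
   move in turn [k.+1]. *)
Definition caught_within (c0 : G) (s : cop_strategy) (r : nat -> G) (n : nat)
  : Prop :=
  exists k, (k <= n /\ cop_pos c0 s r k = r k) \/
            (k < n /\ cop_pos c0 s r k.+1 = r k).

Definition cop_win : Prop :=
  exists (c0 : G) (s : cop_strategy), legal c0 s /\
  forall r, robber_play r -> exists n, caught_within c0 s r n.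

Definition cop_can_catch_within (v u : G) (n : nat) : Prop :=
  exists s : cop_strategy, legal v s /\
  forall r, robber_play r -> r 0 = u -> caught_within v s r n.

End CopsAndRobbers.

Definition calG_vertex : Type := {p : nat * nat | p != (0, 0)}.

Definition calG_adj : rel calG_vertex := fun x y =>
  let: (a, b) := val x in
  let: (c, d) := val y in
  (x != y) &&
  [|| (a == 0) && (c == 0), (b == 0) && (d == 0),
      (a < c) && (d < b) | (c < a) && (b < d)].

Lemma calG_adj_sym : symmetric calG_adj.
Proof.
move=> x y; rewrite /calG_adj eq_sym.
case: (val x) (val y) => a b [c d].
by rewrite (andbC (a == 0)) (andbC (b == 0)) [X in [|| _, _ | X]]orbC.
Qed.

Lemma calG_adj_irr : irreflexive calG_adj.
Proof. by move=> x; rewrite /calG_adj eqxx; case: (val x). Qed.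

Definition calG : sgraph := SGraph calG_adj_sym calG_adj_irr.

(* Main.v *)
Require Import Defs.
From mathcomp Require Import all_boot.
From mathcomp Require Import zify.

Set Implicit Arguments.
Unset Strict Implicit.
Unset Printing Implicit Defensive.

(** The cop jumps to a vertex [(0, Y)] of the vertical axis, with [Y] larger
    than the height of the robber. From there he threatens the whole axis and
    every vertex of height less than [Y], so the robber has to increase his
    height, which forces his first coordinate to decrease strictly. If the
    robber starts in column [a], he is thus caught within [a + 2] turns.

    Conversely, the robber is safe as long as he is strictly above and to the
    right of the cop. A cop move that destroys this in one coordinate decreases
    the other one (or keeps it at [0]), so the robber restores the situation by
    overtaking the cop in the first coordinate and giving up just one unit of
    the second. Starting at [(n + 2, n + 2)] he can afford this [n] times. *)

Definition col (p : calG_vertex) : nat := (val p).1.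
Definition row (p : calG_vertex) : nat := (val p).2.

Lemma calG_eqP (p q : calG_vertex) : p = q <-> col p = col q /\ row p = row q.
Proof.
split=> [-> // | [eq_col eq_row]]; apply: val_inj.
by apply/eqP/andP; split; apply/eqP.
Qed.

Lemma calG_moveP (p q : calG) : move p q <->
  (col p = col q /\ row p = row q) \/ (col p = 0 /\ col q = 0) \/
  (row p = 0 /\ row q = 0) \/ (col p < col q /\ row q < row p) \/
  (col q < col p /\ row p < row q).
Proof.
rewrite /move calG_eqP /= /calG_adj; have [-> | neq_pq] := eqVneq p q.
  by split=> _; left.
rewrite /col /row; case: (val p) (val q) => a b [c d] /=.
by lia.
Qed.

Lemma pairSl_neq0 (a b : nat) : (a.+1, b) != (0, 0).
Proof. by []. Qed.

Lemma pairSr_neq0 (a b : nat) : (a, b.+1) != (0, 0).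
Proof. by rewrite xpair_eqE andbF. Qed.

Definition vertexSl (a b : nat) : calG_vertex :=
  exist _ (a.+1, b) (pairSl_neq0 a b).
Definition vertexSr (a b : nat) : calG_vertex :=
  exist _ (a, b.+1) (pairSr_neq0 a b).

Lemma coordE :
  (forall a b, (col (vertexSl a b) = a.+1) * (row (vertexSl a b) = b)) *
  (forall a b, (col (vertexSr a b) = a) * (row (vertexSr a b) = b.+1)).
Proof. by []. Qed.

Definition reaches (p q : calG_vertex) : bool := (p == q) || calG_adj p q.

Lemma reachesP (p q : calG) : reflect (move p q) (reaches p q).
Proof. by apply: (iffP orP) => -[/eqP|]; [left | right | left | right]. Qed.

(** The new height [row c + row r + 1] exceeds that of the cop, making the jump legal from any
    vertex, and that of the robber. *)
Definition cop_step (c r : calG_vertex) : calG_vertex :=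
  if reaches c r then r else vertexSr 0 (row c + row r).

Lemma cop_step_move (c r : calG) : move c (cop_step c r : calG).
Proof.
rewrite /cop_step; case: reachesP => // _; apply/calG_moveP.
by rewrite !coordE; lia.
Qed.

Definition cop_chase (v : calG) : cop_strategy calG := foldl cop_step v.

Lemma cop_pos_chase (v : calG) (r : nat -> calG) (n : nat) :
  cop_pos v (cop_chase v) r n = foldl cop_step v (mkseq r n).
Proof. by case: n. Qed.

Lemma cop_pos_chaseS (v : calG) (r : nat -> calG) (n : nat) :
  cop_pos v (cop_chase v) r n.+1 =
  cop_step (cop_pos v (cop_chase v) r n) (r n).
Proof. by rewrite !cop_pos_chase mkseqS foldl_rcons. Qed.

Lemma cop_chase_legal (v : calG) : legal v (cop_chase v).
Proof. by move=> r _ n; rewrite cop_pos_chaseS; apply: cop_step_move. Qed.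

Lemma cop_step_escape (c r r' : calG) : ~ move c r -> move r r' ->
  ~ move (cop_step c r : calG) r' -> col r' < col r.
Proof.
rewrite /cop_step; case: reachesP => // _ _; rewrite !calG_moveP.
by rewrite !coordE; lia.
Qed.

Lemma cop_chase_catch (v : calG) (r : nat -> calG) : robber_play r ->
  caught_within v (cop_chase v) r (col (r 0) + 2).
Proof.
move=> play; set c := cop_pos v (cop_chase v) r.
have catch k n : move (c k) (r k) -> k < n -> caught_within v (cop_chase v) r n.
  move=> ck_rk lt_kn; exists k; right; split=> //.
  by rewrite cop_pos_chaseS /cop_step; case: reachesP.
(* Induction on a strict bound for the robber's column: being out of reach on two consecutive turns
   costs him a column. Starting from [m = col (r 0) + 1], the capturing move adds one more turn. *)
suff chase m : forall k, col (r k) < m ->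
    exists2 j, j <= k + m & move (c j) (r j).
  have [j le_j cj_rj] := chase _ 0 (leqnn _).
  by apply: catch cj_rj _; rewrite addn2.
elim: m => // m IHm k le_m.
have [ck_rk | nck] := reachesP (c k) (r k); first by exists k; rewrite ?leq_addr.
have [ck' | nck'] := reachesP (c k.+1) (r k.+1).
  by exists k.+1; first lia.
have := cop_step_escape nck (play k); rewrite -cop_pos_chaseS => /(_ nck') lt_c.
have [|j le_j cj_rj] := IHm k.+1; first by lia.
by exists j; first lia.
Qed.

Definition evasion (c r : calG_vertex) : calG_vertex :=
  if col r <= col c then vertexSl (col c) (row r).-1
  else if row r <= row c then vertexSr (col r).-1 (row c) else r.

(* The test makes the reply legal even against positions that the robber never
   faces. *)
Definition robber_reply (c r : calG_vertex) : calG_vertex :=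
  if reaches r (evasion c r) then evasion c r else r.

Lemma robber_reply_move (c r : calG) : move r (robber_reply c r : calG).
Proof. by rewrite /robber_reply; case: reachesP => // _; left. Qed.

(** The reserve [k] counts the cop moves that the robber can still answer. *)
Definition dominates (k : nat) (c r : calG_vertex) : Prop :=
  [/\ col c < col r, row c < row r, k < col r & k < row r].

Lemma dominates_safe (k : nat) (c r : calG) : dominates k c r -> ~ move c r.
Proof. by case=> ? ? _ _ /calG_moveP; lia. Qed.

(** If the cop draws level in one coordinate, his other one has dropped or is 0. The robber gives up
    a unit there: he stays ahead in the first case by the drop, in the second by his reserve. *)
Lemma dominates_reply (k : nat) (c c' r : calG) :
  dominates k.+1 c r -> move c c' -> dominates k c' (robber_reply c' r).
Proof.
case=> lt_col lt_row k_col k_row /calG_moveP cc'.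
suff [dom rr'] : dominates k c' (evasion c' r) /\ move r (evasion c' r : calG).
  by rewrite /robber_reply; case: reachesP.
rewrite calG_moveP /evasion; case: (leqP (col r) (col c')) => ?.
  by split; [split|]; rewrite !coordE; lia.
case: (leqP (row r) (row c')) => ?; last by split; [split|]; lia.
by split; [split|]; rewrite !coordE; lia.
Qed.

Section Evader.

Variables (s : cop_strategy calG) (u : calG).

(** The cop's move depends on the whole history, so the recursion builds the list of positions; it
    is never empty, so the default of [last] is not reached. *)
Fixpoint evader_history (n : nat) : seq calG :=
  if n is m.+1 then
    let h := evader_history m in
    rcons h (robber_reply (s h) (last u h) : calG)
  else [:: u].

Definition evader (n : nat) : calG := last u (evader_history n).

Lemma mkseq_evader (n : nat) : mkseq evader n.+1 = evader_history n.
Proof.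
by elim: n => //= n IHn; rewrite mkseqS IHn /evader /= last_rcons.
Qed.

Lemma evaderS (v : calG) (n : nat) :
  evader n.+1 = robber_reply (cop_pos v s evader n.+1) (evader n).
Proof. by rewrite /cop_pos mkseq_evader {1}/evader /= last_rcons. Qed.

Lemma evader_play : robber_play evader.
Proof. by move=> n; rewrite (evaderS u); apply: robber_reply_move. Qed.

Lemma evader_dominates (v : calG) (n : nat) : legal v s -> dominates n v u ->
  forall k, k <= n -> dominates (n - k) (cop_pos v s evader k) (evader k).
Proof.
move=> legal_s dom_u; elim=> [|k IHk] lt_kn; first by rewrite subn0.
rewrite (evaderS v); apply: dominates_reply (legal_s _ evader_play k).
by rewrite -subSn // subSS; apply: IHk; apply: ltnW.
Qed.

Lemma evader_not_caught (v : calG) (n : nat) :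
  legal v s -> dominates n v u -> ~ caught_within v s evader n.
Proof.
move=> legal_s dom_u [k [[le_kn met] | [lt_kn met]]].
  have /dominates_safe := evader_dominates legal_s dom_u le_kn.
  by apply; left.
(* Capture by a cop move means that the robber was within reach just before it. *)
have /dominates_safe := evader_dominates legal_s dom_u (ltnW lt_kn).
by apply; rewrite -met; apply: legal_s evader_play k.
Qed.

End Evader.

Theorem theorem1 :
  cop_win calG /\
  (forall u v : calG, exists n : nat, cop_can_catch_within v u n) /\
  ~ (exists n : nat, forall u v : calG, cop_can_catch_within v u n).
Proof.
split; [|split=> [u v | [n catch]]].
- exists (vertexSr 0 0 : calG), (cop_chase (vertexSr 0 0)).
  split=> [|r play]; first exact: cop_chase_legal.
  by exists (col (r 0) + 2); apply: cop_chase_catch.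
- exists (col u + 2), (cop_chase v); split=> [|r play <-].
    exact: cop_chase_legal.
  exact: cop_chase_catch.
- have [s [legal_s]] := catch (vertexSl n.+1 n.+2) (vertexSr 0 0).
  move/(_ _ (@evader_play s _) erefl).
  by apply: evader_not_caught legal_s _; split; rewrite !coordE.
Qed.
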